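(* Let $\mathbb{K}$ be a field, let $\mathcal{F}=\{f_1,\dots,f_k\}$ be a finite family of polynomials in $\mathbb{K}[x_1,\dots,x_n]$ such that $\max_i\deg(f_i)\leq \mathrm{d}_{\mathrm{reg}}(\mathcal{F})$, and let $\sigma$ be a degree-compatible term order. Then $\mathrm{sd}_{\sigma}(\mathcal{F})\leq \mathrm{d}_{\mathrm{reg}}(\mathcal{F})+1$.
   Context: $\mathbb{K}$ is an arbitrary field (not necessarily finite), and $(\mathcal{F})$ denotes the ideal of $\mathbb{K}[x_1,\dots,x_n]$ generated by $\mathcal{F}$. For a nonzero polynomial $p$, $p^{\mathrm{top}}$ is the homogeneous part of largest degree of $p$. For an ideal $\mathcal{I}$, $\mathcal{I}_d$ is the set of homogeneous polynomials of degree $d$ in $\mathcal{I}$ (including $0$). Degree of regularity: $\mathrm{d}_{\mathrm{reg}}(\mathcal{F})$ is the smallest integer $d\ge 0$ for which $(\mathcal{F}^{\mathrm{top}})_d=(\mathbb{K}[x_1,\dots,x_n])_d$, where $\mathcal{F}^{\mathrm{top}}=\{f_1^{\mathrm{top}},\dots,f_k^{\mathrm{top}}\}$ and $(\mathcal{F}^{\mathrm{top}})$ is the ideal it generates; if no such $d$ exists, $\mathrm{d}_{\mathrm{reg}}(\mathcal{F})=+\infty$ (and then the claimed inequality is trivially true). For an integer $d$, $V_{\mathcal{F},d}$ is the smallest $\mathbb{K}$-linear subspace of $\mathbb{K}[x_1,\dots,x_n]$ (with respect to inclusion) such that (i) $\{f\in\mathcal{F}:\deg(f)\leq d\}\subseteq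 V_{\mathcal{F},d}$, and (ii) for every monomial $m$ and every $f\in V_{\mathcal{F},d}$ with $\deg(mf)\leq d$, one has $mf\in V_{\mathcal{F},d}$. A term order is degree-compatible if $\deg(m)<\deg(m')$ implies that $m$ is smaller than $m'$. Solving degree: for a degree-compatible term order $\sigma$, $\mathrm{sd}_{\sigma}(\mathcal{F})$ is the smallest $d$ for which $V_{\mathcal{F},d}$ contains a Gröbner basis of the ideal $(\mathcal{F})$ with respect to $\sigma$. *)

(* Defs.v *)
From mathcomp Require Import all_boot all_order all_algebra.
From mathcomp Require Import boolp classical_sets.
From mathcomp Require Import mpoly.

Set Implicit Arguments.
Unset Strict Implicit.
Unset Printing Implicit Defensive.

Local Open Scope ring_scope.
Local Open Scope classical_set_scope.

(* The extended natural numbers are [option nat], with [None] for +oo.        *)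

Definition le_enat (a b : option nat) : bool :=
  match a, b with
  | _, None => true
  | None, Some _ => false
  | Some x, Some y => (x <= y)%N
  end.

Definition least (P : nat -> Prop) : option nat :=
  if pselect (exists d, `[< P d >]) is left exP then Some (ex_minn exP)
  else None.

Section Polynomials.
Variables (K : fieldType) (n : nat).
Implicit Types (f g p q : {mpoly K[n]}) (m : 'X_{1..n}) (d : nat).
Implicit Types (I S V : set {mpoly K[n]}) (F G : seq {mpoly K[n]}).

(* deg 0 = 0 by convention; this is harmless below, where degrees are only    *)
(* bounded from above by natural numbers.                                     *)
Definition deg p : nat := (msize p).-1.

(* The value at 0 is 0, which is harmless in a set of generators.             *)
Definition top p : {mpoly K[n]} := pihomog mdeg (deg p) p.

Definition is_ideal I : Prop :=
  [/\ I 0, forall p q, I p -> I q -> I (p + q) & forall p q, I q -> I (p * q)].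

Definition ideal S : set {mpoly K[n]} := smallest is_ideal S.

Definition homog_part I d : set {mpoly K[n]} := [set p | I p /\ p \is d.-homog].

Definition dreg F : option nat :=
  least (fun d => homog_part (ideal [set` map top F]) d = homog_part setT d).

Definition is_subspace V : Prop :=
  [/\ V 0, forall p q, V p -> V q -> V (p + q)
    & forall (c : K) p, V p -> V (c *: p)].

Definition mul_closed d V : Prop :=
  forall m f, V f -> (deg ('X_[m] * f) <= d)%N -> V ('X_[m] * f).

Definition Vspace F d : set {mpoly K[n]} :=
  smallest (fun V => is_subspace V /\ mul_closed d V)
           [set f | f \in F /\ (deg f <= d)%N].

(* [sigma m m'] reads: m is smaller than or equal to m'.                      *)
Definition term_order (sigma : rel 'X_{1..n}) : Prop :=
  [/\ total sigma, antisymmetric sigma, transitive sigma,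
      forall m, sigma 0%MM m
    & forall m1 m2 m, sigma m1 m2 -> sigma (m1 + m)%MM (m2 + m)%MM].

Definition degree_compatible (sigma : rel 'X_{1..n}) : Prop :=
  forall m m', (mdeg m < mdeg m')%N -> m != m' /\ sigma m m'.

(* In particular p != 0.                                                      *)
Definition is_lead (sigma : rel 'X_{1..n}) p m : Prop :=
  m \in msupp p /\ {in msupp p, forall m', sigma m' m}.

Definition initial_ideal (sigma : rel 'X_{1..n}) S : set {mpoly K[n]} :=
  ideal [set 'X_[m] | m in [set m | exists2 p, S p & is_lead sigma p m]].

Definition groebner_basis (sigma : rel 'X_{1..n}) I G : Prop :=
  [set` G] `<=` I /\ initial_ideal sigma [set` G] = initial_ideal sigma I.

Definition solving_degree (sigma : rel 'X_{1..n}) F : option nat :=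
  least (fun d => exists G,
    groebner_basis sigma (ideal [set` F]) G /\ [set` G] `<=` Vspace F d).

End Polynomials.

(* Main.v *)
From HB Require Import structures.
Require Import Defs.
From mathcomp Require Import all_boot all_order all_algebra.
From mathcomp Require Import boolp classical_sets.
From mathcomp Require Import ssrcomplements mpoly.


(** Let D be the degree of regularity, I the ideal generated by F, and V the
    space [Vspace F D.+1].  The crux is that V contains {e every} element of I
    of degree at most D+1 ([ideal_small_Vspace]); the statement about Groebner
    bases then follows quickly.

    A monomial of degree D lies in the ideal of the top parts of F, and
    homogeneous combinations of top parts lift to combinations of the elements
    of F in which nothing exceeds the degree considered.  Hence V contains, for
    every monomial m of degree D or D+1, an element equal to m up to lower
    degree, so that every polynomial of degree at most D+1 is congruent modulo V
    to one of degree less than D ([Vspace_reduce]).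

    Consequently Q = P_(<= D+1) / V is represented by polynomials of degree less
    than D, and multiplication by a variable acts on Q: multiply a small
    representative, which gives degree at most D, and reduce.  Two such
    multiplications stay within degree D+1, the range in which congruence modulo
    V is meaningful, so the actions of two variables commute.  This is the
    mechanism behind border bases, and the reason why D+1 suffices.  Hence Q is
    a module over the polynomial ring, and p |-> p . [1] is a module morphism
    which is the class map in degree at most D+1.  Its kernel is an ideal
    containing F, thus I, and it meets degree at most D+1 exactly in V
    ([ideal_small_sub]).

    Finally, every monomial of degree D is the leading monomial of an element of
    I, since the order is degree-compatible.  So the initial ideal of I is
    generated by leading monomials of degree at most D; choosing for each an
    element of I with that leading monomial gives a finite Groebner basis whose
    elements have degree at most D, hence lie in V ([low_basis_groebner]). *)

Set Implicit Arguments.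
Unset Strict Implicit.
Unset Printing Implicit Defensive.

Import GRing.Theory.

Section DegreeOfRegularity.

Local Open Scope ring_scope.
Local Open Scope classical_set_scope.

Context {K : fieldType} {n : nat}.
Implicit Types (p q f w : {mpoly K[n]}) (m : 'X_{1..n}) (i j : 'I_n).
Implicit Types (I W : set {mpoly K[n]}) (F : seq {mpoly K[n]}).

(** * Monomials and degrees *)

Lemma mnm_ind (P : 'X_{1..n} -> Prop) :
  P 0%MM -> (forall i m, P m -> P (U_(i) + m)%MM) -> forall m, P m.
Proof.
move=> P0 PS m; have [k le_mk] := ubnP (mdeg m).
elim: k m le_mk => // k IHk m le_mk.
have [->//|m_neq0] := eqVneq m 0%MM.
have [i mi] : exists i, m i != 0%N.
  apply/existsP; apply: contraNT m_neq0; rewrite negb_exists => /forallP m0.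
  by apply/eqP/mnmP => i; rewrite mnm0E; apply/eqP; rewrite -[_ == _]negbK.
have Um : (U_(i) <= m)%MM by rewrite lep1mP.
rewrite -(submK Um) addmC; apply/PS/IHk.
by move: le_mk; rewrite -{1}(submK Um) mdegD mdeg1 addn1.
Qed.

Lemma mnm_le_mdeg d m :
  (d <= mdeg m)%N -> exists2 m', (m' <= m)%MM & mdeg m' = d.
Proof.
elim/mnm_ind: m => [|i m IHm].
  by rewrite mdeg0 leqn0 => /eqP ->; exists 0%MM; rewrite ?mdeg0 ?lepm_refl.
rewrite mdegD mdeg1 add1n leq_eqVlt => /orP[/eqP ->|].
  by exists (U_(i) + m)%MM; rewrite ?lepm_refl // mdegD mdeg1.
rewrite ltnS => /IHm [m' le_m'm m'd]; exists m' => //.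
exact: lepm_trans le_m'm (lem_addl _ _).
Qed.

Lemma msize_leP p k :
  (msize p <= k)%N <-> (forall m, (k <= mdeg m)%N -> p@_m = 0).
Proof.
split=> [le_pk m le_km|p0].
  by apply/eqP; rewrite mcoeff_eq0 msize_mdeg_ge // (leq_trans le_pk).
rewrite msizeE; apply/bigmax_leqP_seq => m mp _; rewrite ltnNge.
by apply: contraL mp => /p0/eqP; rewrite mcoeff_eq0.
Qed.

Lemma mcoeff_high p k m : (msize p <= k)%N -> (k <= mdeg m)%N -> p@_m = 0.
Proof. by move/msize_leP; apply. Qed.

Lemma msizeB_leq p q k :
  (msize p <= k)%N -> (msize q <= k)%N -> (msize (p - q) <= k)%N.
Proof.
move=> /msize_leP p0 /msize_leP q0; apply/msize_leP => m le_km.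
by rewrite mcoeffB p0 // q0 // subr0.
Qed.

Lemma msize_mulX i p k : (msize p <= k)%N -> (msize ('X_i * p) <= k.+1)%N.
Proof.
have [->|p0] := eqVneq p 0; first by rewrite mulr0 msize0.
move=> le_pk; rewrite msizeM ?msizeX ?mdeg1 //.
by rewrite -msize_poly_eq0 msizeX.
Qed.

Lemma mcoeff_mulX i p m :
  ('X_i * p)@_m = if m i == 0%N then 0 else p@_(m - U_(i)).
Proof.
rewrite mulrC; case: ifPn => [/eqP mi0|mi].
  apply/eqP; rewrite mcoeff_eq0 (perm_mem (msuppMX _ _)); apply/mapP => -[m' _].
  by move=> mE; move: mi0; rewrite mE mnmDE mnm1E eqxx.
have /submK mE : (U_(i) <= m)%MM by rewrite lep1mP.
by rewrite -[in LHS]mE addmC mcoeffMX.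
Qed.

Lemma mcoeff_pihomog d p m : mdeg m = d -> (pihomog mdeg d p)@_m = p@_m.
Proof.
move=> md; rewrite pihomogE [in RHS](mpolyE p) !raddf_sum /= big_mkcond /=.
apply: eq_bigr => k _; rewrite mcoeffZ mcoeffX.
by case: (k =P m) => [->|_]; rewrite ?md ?eqxx // mulr0 if_same.
Qed.

(** * Subspaces and ideals *)

Lemma subspaceB W p q : is_subspace W -> W p -> W q -> W (p - q).
Proof. by case=> _ WD WZ Wp Wq; rewrite -scaleN1r; apply/WD/WZ. Qed.

Lemma subspace_sum W (T : eqType) (r : seq T) (G : T -> {mpoly K[n]}) :
  is_subspace W -> (forall x, x \in r -> W (G x)) -> W (\sum_(x <- r) G x).
Proof.
by case=> W0 WD _ WG; rewrite big_seq; elim/big_ind: _ => //; apply: WG.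
Qed.

Lemma subspace_mpoly W p :
  is_subspace W -> {in msupp p, forall m, W 'X_[m]} -> W p.
Proof.
move=> Wsub WX; rewrite (mpolyE p); apply: subspace_sum => // m mp.
by case: Wsub => _ _; apply; apply: WX.
Qed.

Lemma ideal_subspace I : is_ideal I -> is_subspace I.
Proof.
by case=> I0 ID IM; split=> // c p Ip; rewrite -mul_mpolyC; apply: IM.
Qed.

(** Monomials are products of variables and polynomials are combinations of
    monomials, so only stability under single variables has to be checked. *)
Lemma subspace_is_ideal I : is_subspace I ->
  (forall i p, I p -> I ('X_i * p)) -> is_ideal I.
Proof.
move=> Isub IX; have [I0 ID IZ] := Isub; split=> // p q Iq.
rewrite (mpolyE p) mulr_suml; apply: subspace_sum => // m _.
rewrite -scalerAl; apply: IZ.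
elim/mnm_ind: m => [|i m IHm]; first by rewrite mpolyX0 mul1r.
by rewrite mpolyXD -mulrA; apply: IX.
Qed.

Lemma is_ideal_ideal (S : set {mpoly K[n]}) : is_ideal (ideal S).
Proof.
split=> [|p q Ip Iq|p q Iq] I [II SI]; have [I0 ID IM] := II => //.
- by apply: ID; [apply: Ip|apply: Iq].
- by apply: IM; apply: Iq.
Qed.

Lemma Vspace_props F d :
  [/\ is_subspace (Vspace F d), mul_closed d (Vspace F d)
    & forall f, f \in F -> (deg f <= d)%N -> Vspace F d f].
Proof.
split=> [|m f Vf le_d V VF|f fF le_d V [_ FV]].
- split=> [|p q Vp Vq|c p Vp] V VF; have [[[V0 VD VZ] _] _] := VF => //.
  + by apply: VD; [apply: Vp|apply: Vq].
  + by apply: VZ; apply: Vp.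
- by have [[_ VM] _] := VF; apply: VM => //; apply: Vf.
- exact: FV.
Qed.

Lemma Vspace_sub_ideal F d : Vspace F d `<=` ideal [set` F].
Proof.
have idF := is_ideal_ideal [set` F]; apply: smallest_sub.
  split; first exact: ideal_subspace.
  by move=> m f If _; case: idF => _ _; apply.
by move=> f [fF _]; apply: sub_gen_smallest.
Qed.

(** * The quotient by a space that contains almost everything *)

(** W plays the role of V: a space stable under multiplication by variables as
    long as the degree stays at most D+1, modulo which degree at most D+1
    collapses to degree less than D.  Recall that [msize] is the degree plus
    one. *)
Section Reduction.

Variables (D : nat) (W : set {mpoly K[n]}).
Hypothesis Wsub : is_subspace W.
Hypothesis WX : forall i p, (msize p <= D.+1)%N -> W p -> W ('X_i * p).
Hypothesis Wred : forall p, (msize p <= D.+2)%N ->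
  exists2 q, (msize q <= D)%N & W (p - q).

Let eqW p q := W (p - q).

Lemma eqW_refl p : eqW p p.
Proof. by rewrite /eqW subrr; case: Wsub. Qed.

Lemma eqW_sym p q : eqW p q -> eqW q p.
Proof.
move=> pq; rewrite /eqW -opprB -sub0r; apply: subspaceB => //.
by case: Wsub.
Qed.

Lemma eqW_trans q p r : eqW p q -> eqW q r -> eqW p r.
Proof.
by move=> pq qr; rewrite /eqW -(subrKA q); case: Wsub => _ WD _; apply: WD.
Qed.

(** A small representative is chosen arbitrarily.  The choice need not be linear,
    as only its class modulo W matters. *)
Definition red p := xget 0 [set q | (msize q <= D)%N /\ W (p - q)].

Lemma redP p : (msize p <= D.+2)%N -> (msize (red p) <= D)%N /\ eqW p (red p).
Proof.
move=> /Wred [q qD pq].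
by have := @xgetPex _ 0 [set q | (msize q <= D)%N /\ W (p - q)]; apply; exists q.
Qed.

Lemma redX i p : (msize p <= D.+1)%N ->
  (msize (red ('X_i * p)) <= D)%N /\ eqW ('X_i * p) (red ('X_i * p)).
Proof. by move=> pD; apply/redP/msize_mulX. Qed.

Lemma eqW_mulX i p q : (msize p <= D.+1)%N -> (msize q <= D.+1)%N ->
  eqW p q -> eqW ('X_i * p) ('X_i * q).
Proof. by move=> pD qD pq; rewrite /eqW -mulrBr; apply/WX/pq/msizeB_leq. Qed.

(** The action on the class of 1 of the variables listed in s, through small
    representatives. *)
Definition redword (s : seq 'I_n) := foldr (fun i q => red ('X_i * q)) (red 1) s.

Lemma redword_small s : (msize (redword s) <= D)%N.
Proof.
elim: s => [|i s IHs] /=; first by case: (@redP 1); rewrite ?msize1.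
by case: (redX i (leqW IHs)).
Qed.

Lemma redword_cons i s : eqW ('X_i * redword s) (redword (i :: s)).
Proof. by case: (redX i (leqW (redword_small s))). Qed.

Lemma redword_cons_congr i s t :
  eqW (redword s) (redword t) -> eqW (redword (i :: s)) (redword (i :: t)).
Proof.
move=> st; apply: eqW_trans (redword_cons i t).
apply: eqW_trans (eqW_sym (redword_cons i s)) _.
by apply: eqW_mulX st; apply/leqW/redword_small.
Qed.

(** Both sides are congruent to the honest product of the two variables with the
    small representative of s: that product has degree at most D+1, so no
    reduction takes place outside the range where W is stable. *)
Lemma redword_swap i j s :
  eqW (redword (i :: j :: s)) (redword (j :: i :: s)).
Proof.
have red2 k l : eqW ('X_k * ('X_l * redword s)) (redword (k :: l :: s)).
  apply: eqW_trans (redword_cons k (l :: s)).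
  apply: eqW_mulX (redword_cons l s); first exact/msize_mulX/redword_small.
  exact/leqW/redword_small.
by apply: eqW_trans (red2 j i); rewrite mulrCA; apply/eqW_sym/red2.
Qed.

(** Adjacent transpositions generate all rearrangements. *)
Lemma redword_perm s t : perm_eq s t -> eqW (redword s) (redword t).
Proof.
have move_front i t1 t2 :
    eqW (redword (i :: t1 ++ t2)) (redword (t1 ++ i :: t2)).
  elim: t1 => [|j t1 IH]; first exact: eqW_refl.
  exact: eqW_trans (redword_swap i j _) (redword_cons_congr j IH).
elim: s t => [|i s IHs] t.
  by rewrite perm_sym => /perm_nilP ->; apply: eqW_refl.
move=> st; have it : i \in t by rewrite -(perm_mem st) mem_head.
case/splitPr: it st => t1 t2 st.
apply: eqW_trans (move_front i t1 t2); apply/redword_cons_congr/IHs.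
by rewrite -(perm_cons i) (permPl st) -cat1s perm_catCA.
Qed.

(** Listing the variables of m in a fixed order makes the action of m a function
    of m; by commutation, the order does not matter modulo W. *)
Definition word m := flatten [seq nseq (m i) i | i <- enum 'I_n].

Lemma count_word m i : count_mem i (word m) = m i.
Proof.
rewrite /word count_flatten -map_comp sumnE big_map big_enum /= (bigD1 i) //=.
rewrite count_nseq /= eqxx mul1n big1 ?addn0 // => j /negPf ji.
by rewrite count_nseq /= ji.
Qed.

Definition nf m := redword (word m).

Lemma nf0 : eqW 1 (nf 0%MM).
Proof.
have -> : nf 0%MM = red 1.
  rewrite /nf (_ : word _ = [::]) //; apply/nilP; rewrite /nilp.
  rewrite size_flatten /shape -map_comp sumnE big_map big1 // => i _ /=.
  by rewrite mnm0E.
by case: (@redP 1); rewrite ?msize1.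
Qed.

Lemma nfX i m : eqW ('X_i * nf m) (nf (U_(i) + m)%MM).
Proof.
apply: eqW_trans (redword_cons i (word m)) _; apply: redword_perm.
apply/allP => j _ /=; apply/eqP.
by rewrite [LHS]/= !count_word mnmDE mnm1E.
Qed.

(** Up to degree D+1 a monomial can be multiplied out one variable at a time
    without leaving the range where W is stable. *)
Lemma nf_id m : (mdeg m <= D.+1)%N -> eqW 'X_[m] (nf m).
Proof.
elim/mnm_ind: m => [|i m IHm]; first by rewrite mpolyX0 => _; apply: nf0.
rewrite mdegD mdeg1 ltnS => mD; apply: eqW_trans (nfX i m).
rewrite mpolyXD; apply: eqW_mulX (IHm (leqW mD)); first by rewrite msizeX.
exact/leqW/redword_small.
Qed.

(** The action of p on the class of 1, by linear extension of [nf]. *)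
Definition nfp p := \sum_(m <- msupp p) p@_m *: nf m.

(** A support-independent form of the sum, from which linearity is read off. *)
Lemma nfpE k p : (msize p <= k)%N ->
  nfp p = \sum_(m : 'X_{1..n < k}) p@_m *: nf m.
Proof.
move=> pk; rewrite /nfp (big_mksub 'X_{1..n < k}) ?msupp_uniq //=; last first.
  by move=> m /msize_mdeg_lt /leq_trans; apply.
by rewrite big_rmcond //= => m /memN_msupp_eq0 ->; rewrite scale0r.
Qed.

Lemma nfp_linear : linear nfp.
Proof.
move=> c p q; pose k := maxn (msize (c *: p + q)) (maxn (msize p) (msize q)).
rewrite !(@nfpE k) ?leq_max ?leqnn ?orbT // scaler_sumr -big_split /=.
by apply: eq_bigr => m _; rewrite mcoeffD mcoeffZ scalerDl scalerA.
Qed.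

HB.instance Definition _ := GRing.isLinear.Build K _ _ _ nfp nfp_linear.

Lemma nfp_id p : (msize p <= D.+2)%N -> eqW p (nfp p).
Proof.
move=> pD; rewrite /eqW {1}(mpolyE p) /nfp -sumrB.
apply: subspace_sum => // m mp; rewrite -scalerBr; case: Wsub => _ _; apply.
apply: nf_id; rewrite -ltnS; exact: leq_trans (msize_mdeg_lt mp) pD.
Qed.

Lemma nfp_small p : (msize (nfp p) <= D)%N.
Proof.
apply/msize_leP => m mD; rewrite /nfp raddf_sum /= big1 // => k _.
by rewrite mcoeffZ (mcoeff_high (redword_small _) mD) mulr0.
Qed.

Lemma nfpX i p : eqW ('X_i * nfp p) (nfp ('X_i * p)).
Proof.
have -> : nfp ('X_i * p) = \sum_(m <- msupp p) p@_m *: nf (U_(i) + m)%MM.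
  rewrite {1}(mpolyE p) mulr_sumr linear_sum /=; apply: eq_bigr => m _.
  rewrite -scalerAr linearZ /= -mpolyXD.
  by rewrite /nfp msuppX big_seq1 mcoeffX eqxx scale1r.
rewrite /eqW mulr_sumr -sumrB; apply: subspace_sum => // m _.
rewrite -scalerAr -scalerBr; case: Wsub => _ _; apply; exact: nfX.
Qed.

(** The kernel of p |-> p . [1], as seen through representatives. *)
Lemma nfp_ker_ideal : is_ideal [set p | W (nfp p)].
Proof.
have [W0 WD WZ] := Wsub.
apply: subspace_is_ideal => [|i p /= Wp].
  split=> [|p q|c p] /=; rewrite ?raddf0 ?raddfD ?linearZ //=.
  - exact: WD.
  - exact: WZ.
rewrite -[nfp _](subKr ('X_i * nfp p)); apply: subspaceB => //; last exact: nfpX.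
by apply: WX => //; apply/leqW/nfp_small.
Qed.

(** The kernel of [nfp] modulo W is an ideal, and in degree at most D+1 it
    coincides with W because [nfp] is the identity modulo W there. *)
Lemma ideal_small_sub (S : set {mpoly K[n]}) :
    S `<=` W -> (forall f, S f -> (msize f <= D.+2)%N) ->
  forall p, ideal S p -> (msize p <= D.+2)%N -> W p.
Proof.
move=> SW Ssmall p Ip pD.
have mod_nfp q : (msize q <= D.+2)%N -> W q <-> W (nfp q).
  move=> /nfp_id qW; split=> Wq.
    by rewrite -[nfp q](subKr q); apply: subspaceB.
  by rewrite -(subrK (nfp q) q); case: Wsub => _ WD _; apply: WD.
apply: (iffRL (mod_nfp p pD)); apply: (Ip [set q | W (nfp q)]).
split; first exact: nfp_ker_ideal.
by move=> f Sf; apply: (iffLR (mod_nfp f (Ssmall _ Sf))); apply: SW.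
Qed.

End Reduction.

(** * Lifting from the ideal of top parts *)

Section Lifting.

Variables (D : nat) (W : set {mpoly K[n]}).
Hypothesis Wsub : is_subspace W.
Hypothesis WX : forall i p, (msize p <= D.+1)%N -> W p -> W ('X_i * p).

(** Every homogeneous component of p of degree e <= D+1 is the leading part of an
    element of W without terms of degree above e.  Asking this for all components
    at once, rather than for homogeneous p only, makes the set an ideal, so that
    it contains the ideal of the top parts as soon as it contains the top
    parts. *)
Definition liftable := [set p | forall e, (e <= D.+1)%N -> exists w,
  [/\ W w, (msize w <= e.+1)%N & forall m, mdeg m = e -> w@_m = p@_m]].

Lemma liftable_ideal : is_ideal liftable.
Proof.
have [W0 WD WZ] := Wsub.
apply: subspace_is_ideal => [|i p Lp].
  split=> [|p q Lp Lq|c p Lp] e eD.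
  - by exists 0; split=> //; rewrite msize0.
  - have [v [Wv ve vp]] := Lp e eD; have [w [Ww we wq]] := Lq e eD.
    exists (v + w); split=> [||m me]; first exact: WD.
      by rewrite (leq_trans (msizeD_le _ _)) // geq_max ve we.
    by rewrite !mcoeffD vp // wq.
  - have [v [Wv ve vp]] := Lp e eD.
    exists (c *: v); split=> [||m me]; first exact: WZ.
      by rewrite (leq_trans (msizeZ_le _ _)).
    by rewrite !mcoeffZ vp.
case=> [_|e eD].
  exists 0; split=> // [|m m0]; first by rewrite msize0.
  by move/eqP: m0; rewrite mdeg_eq0 mcoeff_mulX mcoeff0 => /eqP ->; rewrite mnm0E.
have [w [Ww we wp]] := Lp e (ltnW eD).
exists ('X_i * w); split=> [||m me].
- by apply: WX (Ww); apply: leq_trans we _.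
- exact: msize_mulX.
rewrite !mcoeff_mulX; case: ifPn => // mi; apply: wp.
have Um : (U_(i) <= m)%MM by rewrite lep1mP.
by move: me; rewrite -{1}(submK Um) mdegD mdeg1 addn1 => -[].
Qed.

Lemma liftable_top f : W f -> liftable (top f).
Proof.
move=> Wf e eD; have [fe|fe] := eqVneq (deg f) e.
  exists f; split=> // [|m me]; first by rewrite -fe leqSpred.
  by rewrite /top mcoeff_pihomog ?fe.
exists 0; split=> [||m me]; rewrite ?msize0 //; first by case: Wsub.
rewrite mcoeff0; apply/esym/(@dhomog_nemf_coeff _ _ mdeg (deg f)).
  exact: pihomogP.
by move: fe; rewrite eq_sym -me.
Qed.

(** Being reducible from degree e to lower degree modulo W is a linear condition,
    so the case of monomials suffices. *)
Lemma liftable_reduce e : (e <= D.+1)%N ->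
    (forall m, mdeg m = e -> liftable 'X_[m]) ->
  forall p, (msize p <= e.+1)%N -> exists2 q, (msize q <= e)%N & W (p - q).
Proof.
have [W0 WD WZ] := Wsub.
move=> eD Le p pe; pose R := [set p | exists2 q, (msize q <= e)%N & W (p - q)].
apply: (@subspace_mpoly R) => [|m mp].
  split=> [|q r [q' q'e qq'] [r' r'e rr']|c q [q' q'e qq']].
  - by exists 0; rewrite ?msize0 ?subr0.
  - exists (q' + r'); last by rewrite opprD addrACA; apply: WD.
    by rewrite (leq_trans (msizeD_le _ _)) // geq_max q'e r'e.
  - exists (c *: q'); last by rewrite -scalerBr; apply: WZ.
    by rewrite (leq_trans (msizeZ_le _ _)).
have := leq_trans (msize_mdeg_lt mp) pe; rewrite ltnS leq_eqVlt.
case/orP => [/eqP me|me]; last by exists 'X_[m]; rewrite ?msizeX ?subrr.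
have [w [Ww we wm]] := Le m me e eD; exists ('X_[m] - w); last by rewrite subKr.
apply/msize_leP => k; rewrite leq_eqVlt mcoeffB => /orP[/eqP ek|ek].
  by rewrite wm ?subrr.
by rewrite (mcoeff_high we ek) (@mcoeff_high _ e.+1) ?subrr // msizeX me.
Qed.

End Lifting.

(** * The space V in the degree of regularity *)

Section Bound.

Variables (F : seq {mpoly K[n]}) (D : nat).
Hypothesis degF : (\max_(f <- F) deg f <= D)%N.
Hypothesis regF : homog_part (ideal [set` map (@top K n) F]) D = homog_part setT D.

Let V := Vspace F D.+1.
Let I := ideal [set` F].

Lemma degree_le f : f \in F -> (deg f <= D)%N.
Proof. by move=> fF; apply: leq_trans degF; apply: leq_bigmax_seq. Qed.

Lemma VspaceX i p : (msize p <= D.+1)%N -> V p -> V ('X_i * p).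
Proof.
move=> pD Vp; have [_ VM _] := Vspace_props F D.+1; apply: VM => //.
by rewrite /deg -subn1 leq_subLR add1n; apply: msize_mulX.
Qed.

(** The definition of the degree of regularity enters here: a divisor of m of
    degree D lies in the ideal of the top parts. *)
Lemma liftable_monomial m : (D <= mdeg m)%N -> liftable D V 'X_[m].
Proof.
have [Vsub _ FV] := Vspace_props F D.+1.
have Lid := liftable_ideal Vsub VspaceX.
move=> /mnm_le_mdeg [m' m'm m'D].
rewrite -(submK m'm) mpolyXD; case: (Lid) => _ _; apply.
have : homog_part setT D ('X_[m'] : {mpoly K[n]}).
  by split=> //; rewrite dhomogX; apply/eqP.
rewrite -regF => -[Im' _]; apply: Im'; split=> // t /mapP [f fF ->].
by apply: liftable_top => //; apply: FV => //; apply/leqW/degree_le.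
Qed.

(** Remove the component of degree D+1, then the one of degree D. *)
Lemma Vspace_reduce p : (msize p <= D.+2)%N ->
  exists2 q, (msize q <= D)%N & V (p - q).
Proof.
have [Vsub _ _] := Vspace_props F D.+1.
have reduce := liftable_reduce Vsub (D := D).
move=> pD; have [||q qD pq] := reduce D.+1 _ _ p pD => // [m md|].
  by apply: liftable_monomial; rewrite md.
have [||r rD qr] := reduce D _ _ q qD => // [m md|].
  by apply: liftable_monomial; rewrite md.
exists r => //; rewrite -(subrKA q); case: Vsub => _ VD _; exact: VD.
Qed.

Lemma ideal_small_Vspace p : I p -> (msize p <= D.+2)%N -> V p.
Proof.
have [Vsub _ FV] := Vspace_props F D.+1.
have small f : f \in F -> (deg f <= D.+1)%N by move=> /degree_le /leqW.
apply: (ideal_small_sub Vsub VspaceX Vspace_reduce) => [f fF|f fF].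
  by apply: FV => //; apply: small.
by rewrite (leq_trans (leqSpred _)) // ltnS; apply: small.
Qed.

(** * A Groebner basis in low degree *)

Variable sigma : rel 'X_{1..n}.
Hypothesis sigma_order : term_order sigma.
Hypothesis sigma_deg : degree_compatible sigma.

Lemma lead_msize p m : is_lead sigma p m -> (msize p <= (mdeg m).+1)%N.
Proof.
case=> _ lead; apply/msize_leP => k mk; apply/eqP; rewrite mcoeff_eq0.
apply/negP => /lead km; have [neq mk'] := sigma_deg mk.
case: sigma_order => _ anti _ _ _.
by move/eqP: neq; apply; apply: anti; rewrite mk' km.
Qed.

(** The monomial and its reduction modulo V differ by an element of the ideal; the
    reduction has lower degree, so it does not affect the leading monomial. *)
Lemma lead_monomial m : mdeg m = D -> exists2 p, I p & is_lead sigma p m.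
Proof.
move=> mD; have Xm : (msize ('X_[m] : {mpoly K[n]}) <= D.+2)%N.
  by rewrite msizeX mD.
have [q qD Vq] := Vspace_reduce Xm; have q0 := mcoeff_high qD.
exists ('X_[m] - q); first exact: Vspace_sub_ideal Vq.
split=> [|k]; rewrite mcoeff_msupp mcoeffB mcoeffX.
  by rewrite eqxx q0 ?mD // subr0 oner_eq0.
have [->|mk] := eqVneq m k.
  by case: sigma_order => tot _ _ _ _ _; case/orP: (tot k k).
rewrite sub0r oppr_eq0 => qk; have [] := @sigma_deg k m => //.
by rewrite mD ltnNge; apply: contraNN qk => /q0 ->.
Qed.

Definition lead_witness m := xget 0 [set p | I p /\ is_lead sigma p m].

Lemma lead_witnessP m p : I p -> is_lead sigma p m ->
  I (lead_witness m) /\ is_lead sigma (lead_witness m) m.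
Proof.
move=> Ip lead.
by have := @xgetPex _ 0 [set p | I p /\ is_lead sigma p m]; apply; exists p.
Qed.

(** When no element of I has leading monomial m, the witness is 0, which is
    harmless. *)
Definition low_basis : seq {mpoly K[n]} :=
  [seq lead_witness (bmnm m) | m : 'X_{1..n < D.+1}].

Lemma low_basis_mem g : g \in low_basis -> I g /\ V g.
Proof.
have [I0 _ _] : is_ideal I := is_ideal_ideal _.
have [[V0 _ _] _ _] := Vspace_props F D.+1.
case/mapP => m _ ->; rewrite /lead_witness; case: xgetP => [p _ [Ip lead]|_] //.
split=> //; apply: ideal_small_Vspace => //.
by apply: leq_trans (lead_msize lead) _; rewrite ltnS ltnW ?bmdeg.
Qed.

(** A leading monomial of degree above D is a multiple of a monomial of degree D,
    itself a leading monomial of I. *)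
Lemma low_basis_groebner : groebner_basis sigma I low_basis.
Proof.
split=> [g /low_basis_mem []//|].
set J := initial_ideal sigma _; have Jid : is_ideal J by apply: is_ideal_ideal.
have Jlow m p : I p -> is_lead sigma p m -> (mdeg m <= D)%N -> J 'X_[m].
  move=> Ip /(lead_witnessP Ip) [_ lead] mD; apply: sub_gen_smallest.
  exists m => //; exists (lead_witness m) => //.
  by apply/mapP; exists (BMultinom (bound := D.+1) mD); rewrite ?mem_enum.
apply/seteqP; split.
  apply: smallest_sub => [|_ [m [p /low_basis_mem [Ip _] lead] <-]].
    exact: is_ideal_ideal.
  by apply: sub_gen_smallest; exists m => //; exists p.
apply: smallest_sub => // _ [m [p Ip lead] <-].
have [mD|Dm] := leqP (mdeg m) D; first exact: Jlow lead mD.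
have [m' m'm m'D] := mnm_le_mdeg (ltnW Dm).
have [q Iq leadq] := lead_monomial m'D.
rewrite -(submK m'm) mpolyXD; case: Jid => _ _; apply.
by apply: Jlow leadq _; rewrite ?m'D.
Qed.

End Bound.
End DegreeOfRegularity.

(** * Least elements and the bound *)

Lemma least_le (P : nat -> Prop) d : P d -> le_enat (least P) (Some d).
Proof.
move=> Pd; rewrite /least; case: pselect => [exP|[]] /=.
  by case: ex_minnP => e _; apply; apply/asboolP.
by exists d; apply/asboolP.
Qed.

Lemma leastP (P : nat -> Prop) d : least P = Some d -> P d.
Proof.
rewrite /least; case: pselect => // exP [<-].
by case: ex_minnP => e /asboolP.
Qed.

Theorem theorem1p1 (K : fieldType) (n : nat) (F : seq {mpoly K[n]})
    (sigma : rel 'X_{1..n})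
    (Hdeg : le_enat (Some (\max_(f <- F) deg f)%N) (dreg F))
    (Hsigma : term_order sigma) (Hcompat : degree_compatible sigma) :
  le_enat (solving_degree sigma F) (omap succn (dreg F)).
Proof.
case E : (dreg F) Hdeg => [D|] /= degF; last by case: (solving_degree _ _).
have regF := leastP E; apply: least_le; exists (low_basis F D sigma).
split; first exact: low_basis_groebner.
by move=> g /(low_basis_mem degF regF Hsigma Hcompat) [].
Qed.
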